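(* Let $X$ be an $L_1$-predual space, let $F$ be a non-empty compact subset of $X$ and let $V$ be a non-empty closed convex subset of $X$. Then $$\mathrm{rad}_{V}(F)=\mathrm{rad}_{X}(F)+d(V,\mathrm{cent}_{X}(F)).$$ Furthermore, $\mathrm{cent}_{V}(F)\neq\emptyset$ if and only if there exist $v_{0}\in V$ and $x_{0}\in\mathrm{cent}_{X}(F)$ such that $d(V,\mathrm{cent}_{X}(F))=\|v_{0}-x_{0}\|$.
   Context: All Banach spaces are real. A Banach space $X$ is an $L_1$-predual space if its dual $X^{\ast}$ is isometric to $L_{1}(\mu)$ for some positive measure $\mu$. For a non-empty closed bounded $B\subseteq X$, a non-empty closed convex $V\subseteq X$ (possibly $V=X$) and $x\in X$, put $r(x,B)=\sup\{\|x-b\|:b\in B\}$, $\mathrm{rad}_{V}(B)=\inf_{v\in V}r(v,B)$, and $\mathrm{cent}_{V}(B)=\{v\in V:r(v,B)=\mathrm{rad}_{V}(B)\}$. For $A,B\subseteq X$, $d(A,B)=\inf\{\|a-b\|:a\in A,\ b\in B\}$. In an $L_1$-predual space $\mathrm{cent}_{X}(F)\ne\emptyset$ for every non-empty compact $F\subseteq X$. *)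

(* Defs.v *)
From HB Require Import structures.
From mathcomp Require Import all_boot all_order all_algebra.
From mathcomp Require Import all_classical all_reals all_analysis.
From mathcomp Require Import measurable_realfun.

Set Implicit Arguments.
Unset Strict Implicit.
Unset Printing Implicit Defensive.

Import Order.TTheory GRing.Theory Num.Theory.
Import numFieldNormedType.Exports.

Local Open Scope classical_set_scope.
Local Open Scope ring_scope.

Definition continuous_dual (R : realType) (X : normedModType R) :
    set (X -> R) :=
  [set phi : X -> R | scalar phi /\ continuous phi].
Arguments continuous_dual {R} X _.

(* The supremum is taken in \bar R because L1-norms are extended real valued in
   the library; it is finite on [continuous_dual X]. *)
Definition dual_norm (R : realType) (X : normedModType R) (phi : X -> R) :
    \bar R :=
  ereal_sup [set `|phi x|%:E | x in [set x : X | `|x| <= 1]].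

(* [J] is a surjective linear isometry from L_1(mu) onto the dual of X.  The
   elements of [LspaceType1 mu] are classes modulo equality mu-a.e., and the
   library gives this quotient no vector space structure: "h = a f + g in
   L_1(mu)" is expressed on representatives.  Injectivity of [J] follows from
   linearity and preservation of the norm. *)
Definition isometry_L1_dual (R : realType) (X : normedModType R)
    (d : measure_display) (T : measurableType d)
    (mu : {measure set T -> \bar R}) (J : LspaceType1 mu -> X -> R) : Prop :=
  [/\ range J = continuous_dual X,
      forall (a : R) (f g h : LspaceType1 mu),
        h = (fun t => a * f t + g t) %[ae mu] ->
        J h = (fun x => a * J f x + J g x)
    & forall f : LspaceType1 mu, dual_norm (J f) = 'N[mu]_1[EFin \o f]%E].

Definition L1_predual (R : realType) (X : completeNormedModType R) : Prop :=
  exists (d : measure_display) (T : measurableType d)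
         (mu : {measure set T -> \bar R}) (J : LspaceType1 mu -> X -> R),
    isometry_L1_dual J.

(* [sup] and [inf] are those of R, with value 0 on sets that are empty or not
   bounded on the relevant side.  In [radius_at] and [rad_in], B is thus meant
   to be non-empty and bounded, and V non-empty; in [set_dist], A and B are
   meant to be non-empty. *)
Definition radius_at (R : realType) (X : normedModType R) (x : X) (B : set X) :
    R :=
  sup [set `|x - b| | b in B].

Definition rad_in (R : realType) (X : normedModType R) (V B : set X) : R :=
  inf [set radius_at v B | v in V].

Definition cent_in (R : realType) (X : normedModType R) (V B : set X) : set X :=
  [set v | V v /\ radius_at v B = rad_in V B].

Definition set_dist (R : realType) (X : normedModType R) (A B : set X) : R :=
  inf [set `|a - b| | a in A & b in B].

(* Main.v *)
Require Import Defs.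
From HB Require Import structures.
From mathcomp Require Import all_boot all_order all_algebra finmap.
From mathcomp Require Import all_classical all_reals all_analysis.
From mathcomp Require Import measurable_realfun.
From mathcomp Require Import ring lra.

(** The key point is Lindenstrauss's theorem: in an [L_1]-predual, closed balls
    that pairwise intersect (in the sense that the distance of the centers is at
    most the sum of the radii) have a common point, as soon as the family of
    (center, radius) pairs is compact.  Applied to the balls of radius
    [rad_X(F)] around the points of [F] together with the ball of radius
    [r(v, F) - rad_X(F)] around a given [v], it yields a center [c] of [F] with
    [|v - c| <= r(v, F) - rad_X(F)].  The converse inequality is the triangle
    inequality, and both claims follow.

    For finitely many balls with radii enlarged by [e], a common point is
    obtained by contradiction from Hahn-Banach in [X^n]: one gets functionals
    [phi_i] with [sum_i phi_i = 0] and
    [sum_i (r_i + e) |phi_i| <= 1 <= - sum_i phi_i(x_i)].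
    In [L_1] one can write [phi_i = sum_j g_ij] with [g_ji = - g_ij] and
    [|phi_i| = sum_j |g_ij|], whence
    [- sum_i phi_i(x_i) = 1/2 sum_ij g_ij(x_j - x_i) <= sum_i r_i |phi_i|], so
    that all the [phi_i] vanish, which is absurd.  Compactness extends this to
    infinite families, and the enlargement [e] is removed by successive
    approximation, adding at each step a small ball around the last point. *)

Set Implicit Arguments.
Unset Strict Implicit.
Unset Printing Implicit Defensive.

Import Order.TTheory GRing.Theory Num.Theory.
Import numFieldNormedType.Exports.

Local Open Scope classical_set_scope.
Local Open Scope ring_scope.

(** * Sublinear functionals and the Hahn-Banach theorem *)

Definition sublinear (R : realType) (V : lmodType R) (p : V -> R) : Prop :=
  (forall x y, p (x + y) <= p x + p y) /\
  (forall t x, 0 <= t -> p (t *: x) = t * p x).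

Lemma sublinear0 (R : realType) (V : lmodType R) (p : V -> R) :
  sublinear p -> p 0 = 0.
Proof. by move=> [_ pZ]; rewrite -(scale0r 0) pZ ?mul0r. Qed.

Lemma sublinear_geN (R : realType) (V : lmodType R) (p : V -> R) (x : V) :
  sublinear p -> - p (- x) <= p x.
Proof.
move=> sp; have := sp.1 x (- x).
by rewrite subrr (sublinear0 sp); lra.
Qed.

Lemma sublinearP (R : realType) (V : lmodType R) (p : V -> R) :
  (forall x y, p (x + y) <= p x + p y) -> p 0 <= 0 ->
  (forall t x, 0 < t -> p (t *: x) <= t * p x) -> sublinear p.
Proof.
move=> pD p0 pZ; split=> // t x; rewrite le_eqVlt => /predU1P[<-|t0].
  by have := pD 0 0; rewrite scale0r addr0; lra.
apply/eqP; rewrite eq_le pZ //=.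
have ti : 0 < t^-1 by rewrite invr_gt0.
have := pZ _ (t *: x) ti.
by rewrite scalerA mulVf ?gt_eqF // scale1r -ler_pdivrMl ?invr_gt0 // invrK.
Qed.

Section sublinear_descent.
Context (R : realType) (V : lmodType R) (p : V -> R) (C : set V) (b : R).
Hypotheses (sp : sublinear p) (C0 : C !=set0).
Hypothesis convC : forall x y t, C x -> C y -> 0 <= t <= 1 ->
  C (t *: x + (1 - t) *: y).
Hypothesis pC : forall c, C c -> b <= p c.

(** The infimum [q] of these values is the largest sublinear functional below [p] that is at most
    [- b] on [- C]: any such [q'] satisfies [q' y <= q' (y + t c) + t q' (- c) <= p (y + t c) - t
    b]. *)
Let values (y : V) : set R :=
  [set r | exists t c, [/\ 0 <= t, C c & r = p (y + t *: c) - t * b]].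

Let q (y : V) : R := inf (values y).

Let q_lb y : lbound (values y) (- p (- y)).
Proof.
move=> _ [t [c [t0 Cc ->]]].
have h : p (t *: c) <= p (y + t *: c) + p (- y).
  by rewrite -{1}(addKr y (t *: c)) (addrC (- y)); apply: sp.1.
have := ler_wpM2l t0 (pC Cc); rewrite sp.2 // in h => h2.
by lra.
Qed.

Let values_in y t c : 0 <= t -> C c -> values y (p (y + t *: c) - t * b).
Proof. by move=> t0 Cc; exists t, c. Qed.

Let values_inf y : has_inf (values y).
Proof.
case: C0 => c Cc; split; last by exists (- p (- y)); exact: q_lb.
by exists (p (y + 0 *: c) - 0 * b); exact: values_in.
Qed.

Let q_le y t c : 0 <= t -> C c -> q y <= p (y + t *: c) - t * b.
Proof.
move=> t0 Cc; apply: ge_inf; last exact: values_in.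
by case: (values_inf y).
Qed.

Let q_glb y z : lbound (values y) z -> z <= q y.
Proof. by move=> zb; apply: lb_le_inf => //; case: (values_inf y). Qed.

(* Convexity of [C] merges the two shifts [t c] and [t' c'] into
   [(t + t') c'']. *)
Let convC_merge t t' c c' : 0 <= t -> 0 <= t' -> C c -> C c' ->
  exists2 c'', C c'' & t *: c + t' *: c' = (t + t') *: c''.
Proof.
move=> t0 t'0 Cc Cc'.
have [s0|s0] := eqVneq (t + t') 0.
  have -> : t = 0 by lra.
  have -> : t' = 0 by lra.
  by exists c => //; rewrite addr0 !scale0r addr0.
have sgt0 : 0 < t + t' by rewrite lt_neqAle eq_sym s0 addr_ge0.
exists (t / (t + t') *: c + (1 - t / (t + t')) *: c').
  apply: convC => //; rewrite divr_ge0 ?addr_ge0 //=.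
  by rewrite ler_pdivrMr // mul1r lerDl.
rewrite scalerDr !scalerA; congr (_ *: _ + _ *: _).
  by field.
by field.
Qed.

Lemma sublinear_descent :
  exists q : V -> R, [/\ sublinear q, forall x, q x <= p x
                       & forall c, C c -> q (- c) <= - b].
Proof.
exists q; split; first apply: sublinearP.
- move=> x y; rewrite -lerBlDr; apply: q_glb => _ [t [c [t0 Cc ->]]].
  rewrite lerBlDr -lerBlDl; apply: q_glb => _ [t' [c' [t'0 Cc' ->]]].
  have [c'' Cc'' cE] := convC_merge t0 t'0 Cc Cc'.
  have := q_le (x + y) (addr_ge0 t0 t'0) Cc''; rewrite -cE addrACA.
  have := sp.1 (x + t *: c) (y + t' *: c').
  by rewrite mulrDl; lra.
- case: C0 => c Cc; have := q_le 0 (lexx 0) Cc.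
  by rewrite scale0r addr0 mul0r subr0 (sublinear0 sp).
- move=> t x t0; rewrite -ler_pdivrMl //; apply: q_glb => _ [s [c [s0 Cc ->]]].
  rewrite ler_pdivrMl //.
  have := q_le (t *: x) (mulr_ge0 (ltW t0) s0) Cc.
  by rewrite -scalerA -scalerDr sp.2 ?(ltW t0) // mulrBr mulrA.
- move=> x; case: C0 => c Cc; have := q_le x (lexx 0) Cc.
  by rewrite scale0r addr0 mul0r subr0.
- move=> c Cc; have := q_le (- c) ler01 Cc.
  by rewrite scale1r addNr (sublinear0 sp) mul1r sub0r.
Qed.

End sublinear_descent.

(** Zorn's lemma for the reversed pointwise order. A chain is bounded by its pointwise infimum,
    finite because every member is at least [- p (- x)] at [x]. *)
Lemma minimal_sublinear (R : realType) (V : lmodType R) (p : V -> R) :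
  sublinear p ->
  exists q : V -> R, [/\ sublinear q, forall x, q x <= p x
    & forall q', sublinear q' -> (forall x, q' x <= q x) -> q' = q].
Proof.
move=> sp.
pose T := {q : V -> R | sublinear q /\ forall x, q x <= p x}.
pose below (f g : T) : bool := `[< forall x, sval g x <= sval f x >].
have [//| | | |[q [sq qp]] qmin] := @Zorn T below.
- by move=> f; apply/asboolP.
- by move=> f g h /asboolP fg /asboolP gh; apply/asboolP => x;
     exact: le_trans (gh x) (fg x).
- move=> [f pf] [g pg] /asboolP /= fg /asboolP /= gf; apply: eq_exist.
  by apply/funext => x; apply/eqP; rewrite eq_le gf fg.
- move=> A totA.
  have [[f0 Af0]|A0] := pselect (A !=set0); last first.
    exists (exist _ p (conj sp (fun x => lexx _))) => s As.
    by exfalso; apply: A0; exists s.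
  pose vals x := [set sval f x | f in A].
  have vals_inf x : has_inf (vals x).
    split; first by exists (sval f0 x), f0.
    exists (- p (- x)) => _ [[f [sf fp]] Af <-] /=.
    by apply: le_trans (sublinear_geN x sf); rewrite lerN2.
  pose q x := inf (vals x).
  have q_le f x : A f -> q x <= sval f x.
    by move=> Af; apply: ge_inf; [case: (vals_inf x)|exists f].
  have q_glb x z : (forall f, A f -> z <= sval f x) -> z <= q x.
    move=> zA; apply: lb_le_inf; first by case: (vals_inf x).
    by move=> _ [f Af <-]; exact: zA.
  suff hq : sublinear q /\ forall x, q x <= p x.
    by exists (exist _ q hq) => f Af; apply/asboolP => x /=; exact: q_le.
  split; last first.
    by move=> x; apply: le_trans (q_le _ _ Af0) _; exact: (svalP f0).2.
  apply: sublinearP.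
  + move=> x y; rewrite -lerBlDr; apply: (q_glb) => f Af.
    rewrite lerBlDr -lerBlDl; apply: (q_glb) => g Ag.
    rewrite lerBlDl.
    (* Subadditivity of the infimum needs one function for both arguments: the smaller of [f] and
       [g]. *)
    have [/asboolP fg|/asboolP gf] := totA _ _ Af Ag.
    * apply: (le_trans (q_le _ _ Ag)); apply: (le_trans ((svalP g).1.1 _ _)).
      by rewrite lerD2r fg.
    * apply: (le_trans (q_le _ _ Af)); apply: (le_trans ((svalP f).1.1 _ _)).
      by rewrite lerD2l gf.
  + by rewrite -(sublinear0 (svalP f0).1) q_le.
  + move=> t x t0; rewrite -ler_pdivrMl //; apply: (q_glb) => f Af.
    rewrite ler_pdivrMl //; have := q_le f (t *: x) Af.
    by rewrite (svalP f).1.2 // ltW.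
- exists q; split=> // q' sq' q'q.
  have q'p x : q' x <= p x by exact: le_trans (q'q x) (qp x).
  have := qmin (exist _ q' (conj sq' q'p)).
  by move=> /(_ (asboolT q'q)) /(congr1 sval).
Qed.

(* Descending from [q] along the convex set [{x}] with bound [q x] cannot go
   strictly below [q], so that [q (- x) <= - q x]. *)
Lemma minimal_sublinear_scalar (R : realType) (V : lmodType R) (q : V -> R) :
  sublinear q ->
  (forall q', sublinear q' -> (forall x, q' x <= q x) -> q' = q) -> scalar q.
Proof.
move=> sq qmin.
have qN x : q (- x) = - q x.
  apply/eqP; rewrite eq_le; apply/andP; split; last first.
    by have := sublinear_geN (- x) sq; rewrite opprK.
  have x0 : [set x] !=set0 by exists x.
  have convx y z t : [set x] y -> [set x] z -> 0 <= t <= 1 ->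
      [set x] (t *: y + (1 - t) *: z).
    by move=> -> -> _; rewrite /= -scalerDl addrC subrK scale1r.
  have qx c : [set x] c -> q x <= q c by move=> ->.
  have [q' [sq' q'q q'N]] := sublinear_descent sq x0 convx qx.
  by rewrite (qmin _ sq' q'q) in q'N; exact: q'N.
have qD x y : q (x + y) = q x + q y.
  apply/eqP; rewrite eq_le sq.1 /=.
  by have := sq.1 (- x) (- y); rewrite -opprD !qN -opprD lerN2.
move=> a x y; rewrite qD; congr (_ + _).
have [a0|a0] := leP 0 a; first exact: sq.2.
rewrite -[a]opprK scaleNr qN sq.2 ?oppr_ge0 ?ltW //.
by rewrite /= !mulNr.
Qed.

(** Descent along [C] forces the bound [- b] on [- C]; a minimal sublinear functional below is
    linear, and oddness turns that bound into [b] from below on [C]. *)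
Lemma hahn_banach_convex (R : realType) (V : lmodType R) (p : V -> R)
    (C : set V) (b : R) :
  sublinear p -> C !=set0 ->
  (forall x y t, C x -> C y -> 0 <= t <= 1 -> C (t *: x + (1 - t) *: y)) ->
  (forall c, C c -> b <= p c) ->
  exists phi : V -> R, [/\ scalar phi, forall x, phi x <= p x
                         & forall c, C c -> b <= phi c].
Proof.
move=> sp C0 convC pC.
have [q [sq qp qC]] := sublinear_descent sp C0 convC pC.
have [phi [sphi phiq /(minimal_sublinear_scalar sphi) lphi]] :=
  minimal_sublinear sq.
exists phi; split=> // [x|c Cc]; first exact: le_trans (phiq x) (qp x).
rewrite -lerN2; apply: le_trans (qC _ Cc); apply: le_trans (phiq _).
by rewrite -scaleN1r -[_ *: c]addr0 lphi (sublinear0 sphi) addr0 mulN1r.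
Qed.

(** * Linear functionals *)

Section scalar_theory.
Context (R : realType) (V : lmodType R) (phi : V -> R).
Hypothesis sphi : scalar phi.

Lemma scalarD x y : phi (x + y) = phi x + phi y.
Proof. by rewrite -{1}[x]scale1r sphi mul1r. Qed.

Lemma scalar0 : phi 0 = 0.
Proof. by have := scalarD 0 0; rewrite addr0; lra. Qed.

Lemma scalarZ a x : phi (a *: x) = a * phi x.
Proof. by rewrite -[a *: x]addr0 sphi scalar0 addr0. Qed.

Lemma scalarN x : phi (- x) = - phi x.
Proof. by rewrite -scaleN1r scalarZ mulN1r. Qed.

Lemma scalarB x y : phi (x - y) = phi x - phi y.
Proof. by rewrite scalarD scalarN. Qed.

Lemma scalar_sum (I : finType) (v : I -> V) :
  phi (\sum_i v i) = \sum_i phi (v i).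
Proof.
by elim/big_rec2: _ => [|i y x _ <-]; rewrite ?scalar0 ?scalarD.
Qed.

End scalar_theory.

(** * Antisymmetric splitting of a family of reals with sum zero *)

Section transfer.
Context (R : realType) (I : finType).
Implicit Types (a : I -> R) (i j : I).

(* With [a^+], [a^-] the positive and negative parts of [a] and [S = sum a^+]
   (equal to [sum a^-] when [sum a = 0]), the mass
   [(a_i^+ a_j^- - a_i^- a_j^+) / S] is sent from [j] to [i]; the value is [0]
   if [S = 0]. *)
Definition transfer a i j : R :=
  (Num.max (a i) 0 * Num.max (- a j) 0 - Num.max (- a i) 0 * Num.max (a j) 0) /
  \sum_k Num.max (a k) 0.

Let pos_ge0 (x : R) : 0 <= Num.max x 0.
Proof. by rewrite le_max lexx orbT. Qed.

Let posB (x : R) : Num.max x 0 - Num.max (- x) 0 = x.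
Proof. by rewrite /Num.max; case: ifPn => ?; case: ifPn => ?; lra. Qed.

Let posD (x : R) : Num.max x 0 + Num.max (- x) 0 = `|x|.
Proof.
by rewrite /Num.max; case: ifPn => ?; case: ifPn => ?;
  have [?|?] := ler0P x; lra.
Qed.

Let pos_le_sum a i : Num.max (a i) 0 <= \sum_k Num.max (a k) 0.
Proof. by rewrite (bigD1 i) //= lerDl sumr_ge0. Qed.

(** One of [a_i^+] and [a_i^-] is zero, so at most one product survives. *)
Let norm_numer a i j :
  `|Num.max (a i) 0 * Num.max (- a j) 0 - Num.max (- a i) 0 * Num.max (a j) 0| =
  Num.max (a i) 0 * Num.max (- a j) 0 + Num.max (- a i) 0 * Num.max (a j) 0.
Proof.
have h (x : R) : Num.max x 0 = 0 \/ Num.max (- x) 0 = 0.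
  by rewrite /Num.max; case: ifPn => ?; case: ifPn => ?; lra.
by have [->|->] := h (a i); rewrite !mul0r ?sub0r ?subr0 ?add0r ?addr0 ?normrN
  ger0_norm // mulr_ge0.
Qed.

Let sum_neg a : \sum_k a k = 0 ->
  \sum_k Num.max (- a k) 0 = \sum_k Num.max (a k) 0.
Proof.
move=> a0; apply/esym/eqP; rewrite -subr_eq0 -sumrB -[X in _ == X]a0.
by apply/eqP; apply: eq_bigr => k _; exact: posB.
Qed.

Let sum_pos_eq0 a i : \sum_k a k = 0 -> \sum_k Num.max (a k) 0 = 0 ->
  a i = 0.
Proof.
move=> a0 S0; have := pos_le_sum a i; rewrite S0 => pi.
have := pos_le_sum (fun k => - a k) i; rewrite sum_neg // S0 => ni.
have := pos_ge0 (a i); have := pos_ge0 (- a i).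
by have := posB (a i); lra.
Qed.

Lemma transferN a i j : transfer a j i = - transfer a i j.
Proof. by rewrite /transfer -[RHS]mulNr; congr (_ / _); ring. Qed.

(** [S] dominates every [a_k^+], so each product divided by [S] is at most its negative-part factor.
    This bound will give integrability. *)
Lemma norm_transfer_le a i j : `|transfer a i j| <= `|a i| + `|a j|.
Proof.
rewrite /transfer normrM norm_numer -2!posD.
have S0 : 0 <= \sum_k Num.max (a k) 0 by exact: sumr_ge0.
have pi := pos_le_sum a i; have pj := pos_le_sum a j.
rewrite normfV (ger0_norm S0).
have [SE|S1] := eqVneq (\sum_k Num.max (a k) 0) 0.
  by rewrite SE invr0 mulr0 !addr_ge0.
rewrite ler_pdivrMr; last by rewrite lt_neqAle eq_sym S1.
move: (pos_ge0 (a i)) (pos_ge0 (- a i)) (pos_ge0 (a j)) (pos_ge0 (- a j)).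
by nra.
Qed.

(** Both parts of [a] have total [S], so the numerators sum to [(a_i^+ - a_i^-) S]. If [S = 0] the
    whole family vanishes, in accordance with the value 0 of the quotient. *)
Lemma sum_transfer a i : \sum_k a k = 0 -> \sum_j transfer a i j = a i.
Proof.
move=> a0; rewrite -mulr_suml sumrB -!mulr_sumr sum_neg // -mulrBl posB.
have [S0|S0] := eqVneq (\sum_k Num.max (a k) 0) 0; last by rewrite mulfK.
by rewrite S0 mulr0 mul0r (sum_pos_eq0 i).
Qed.

Lemma sum_norm_transfer a i : \sum_k a k = 0 ->
  \sum_j `|transfer a i j| = `|a i|.
Proof.
move=> a0; under eq_bigr do rewrite normrM norm_numer normfV.
rewrite -mulr_suml big_split /= -!mulr_sumr sum_neg // -mulrDl posD.
rewrite (ger0_norm (sumr_ge0 _ _)) //.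
have [S0|S0] := eqVneq (\sum_k Num.max (a k) 0) 0; last by rewrite mulfK.
by rewrite S0 mulr0 mul0r (sum_pos_eq0 i) // normr0.
Qed.

Lemma measurable_transfer d (T : measurableType d) (f : I -> T -> R) i j :
  (forall k, measurable_fun setT (f k)) ->
  measurable_fun setT (fun t => transfer (f ^~ t) i j).
Proof.
move=> mf.
have mp k : measurable_fun setT (fun t => Num.max (f k t) 0).
  by apply: measurable_maxr.
have mn k : measurable_fun setT (fun t => Num.max (- f k t) 0).
  by apply: measurable_maxr => //; exact: measurableT_comp.
apply: measurable_funM.
  by apply: measurable_funB; apply: measurable_funM.
(* The inverse is written as a power with exponent -1; both agree on non-negative reals, with value
   0 at 0. *)
rewrite (_ : (fun t => _) = (fun t => (\sum_k Num.max (f k t) 0) `^ (-1))).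
  apply: (measurableT_comp (measurable_powR (-1))).
  by apply: measurable_sum.
apply/funext => t; rewrite powR_inv1 //; exact: sumr_ge0.
Qed.

End transfer.

(** * Classes in L_1 and the isometry onto the dual *)

Section L1_classes.
Context (R : realType) (d : measure_display) (T : measurableType d)
  (mu : {measure set T -> \bar R}).

Lemma Lspace1_class (h : T -> R) :
  h \in Lfun mu 1 -> exists F : LspaceType1 mu, F = h %[ae mu].
Proof.
rewrite inE => /andP[]; rewrite !inE /= => mh fh.
pose hm : {mfun T >-> measurableTypeR R} :=
  HB.pack (h : T -> measurableTypeR R)
    (isMeasurableFun.Build _ _ T (measurableTypeR R) h mh).
pose q : {mfun_ mu, T >-> measurableTypeR R} :=
  (\pi_({mfun_ mu, T >-> measurableTypeR R}) hm)%qT.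
have qh : q = h %[ae mu] by have /eqmodP/asboolP := reprK q.
have qfin : finite_norm mu 1 q.
  rewrite /finite_norm Lnorm1 (@ge0_ae_eq_integral _ _ _ mu _ _
    (fun t => `|(h t)%:E|%E)) //; first by rewrite -Lnorm1.
  - by apply: measurableT_comp => //; apply/measurable_EFinP;
      exact: (measurable_funP (repr q)).
  - by apply: measurableT_comp => //; exact/measurable_EFinP.
  - by apply: filterS qh => t /= qt /qt ->.
pose Q : LspaceType1 mu :=
  HB.pack q (@isFinLebesgue.Build d T R mu 1%E (@lexx _ _ 1%E) q qfin).
by exists Q.
Qed.

Lemma Lspace1_Lfun (F : LspaceType1 mu) : (F : T -> R) \in Lfun mu 1.
Proof.
rewrite inE; apply/andP; split; rewrite inE /=.
  exact: measurable_funP (repr (F : {mfun_ mu, T >-> measurableTypeR R})).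
exact: Lebesgue_finite.
Qed.

End L1_classes.

Section L1_dual.
Context (R : realType) (X : normedModType R) (d : measure_display)
  (T : measurableType d) (mu : {measure set T -> \bar R})
  (J : LspaceType1 mu -> X -> R).
Hypothesis hJ : isometry_L1_dual J.

Let J_lin (a : R) (f g h : LspaceType1 mu) :
  h = (fun t => a * f t + g t) %[ae mu] -> J h = (fun x => a * J f x + J g x).
Proof. by case: hJ => _ + _; apply. Qed.

Let zero_class : exists z : LspaceType1 mu, z = (fun=> 0) %[ae mu].
Proof.
apply: Lspace1_class; apply/Lfun1_integrable; exact: integrable0.
Qed.

(** Since [z = 1 z + z] a.e., linearity yields [J z = J z + J z]. *)
Lemma isometry_eq0 (z : LspaceType1 mu) :
  z = (fun=> 0) %[ae mu] -> J z = (fun=> 0).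
Proof.
move=> z0; have /(congr1 (fun f => f _)) E : J z = fun x => 1 * J z x + J z x.
  by apply: J_lin; apply: filterS z0 => t /= zt /zt ->; rewrite mulr0 addr0.
by apply/funext => x; have := E x; lra.
Qed.

Lemma isometry_ae_eq (a : R) (f g : LspaceType1 mu) :
  g = (fun t => a * f t) %[ae mu] -> J g = (fun x => a * J f x).
Proof.
move=> gf; have [z z0] := zero_class.
have -> : J g = fun x => a * J f x + J z x.
  apply: J_lin; apply: filterS2 gf z0 => t /= gt zt tT.
  by rewrite gt // zt // addr0.
by apply/funext => x; rewrite (isometry_eq0 z0) addr0.
Qed.

(** Linearity of [J] handles two terms at a time, and each partial sum must be realised by a class
    of its own; hence the induction on the index list. *)
Lemma isometry_sum_exists (I : finType) (f : I -> LspaceType1 mu) :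
  exists s : LspaceType1 mu,
    s = (fun t => \sum_i f i t) %[ae mu] /\ J s = (fun x => \sum_i J (f i) x).
Proof.
elim: (index_enum I) => [|i r [s [sE JsE]]].
  have [z z0] := zero_class; exists z; split.
    by apply: filterS z0 => t /= zt /zt ->; rewrite big_nil.
  by apply/funext => x; rewrite (isometry_eq0 z0) big_nil.
have [u uE] : exists u : LspaceType1 mu, u = (fun t => f i t + s t) %[ae mu].
  apply: Lspace1_class.
  exact: (Lfun_addr_closed mu (lexx 1%E)).2 (Lspace1_Lfun _) (Lspace1_Lfun _).
exists u; split.
  apply: filterS2 uE sE => t /= ut st tT.
  by rewrite ut // st // big_cons.
have -> : J u = fun x => 1 * J (f i) x + J s x.
  by apply: J_lin; apply: filterS uE => t /= ut /ut ->; rewrite mul1r.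
by apply/funext => x; rewrite JsE big_cons mul1r.
Qed.

Lemma isometry_sum (I : finType) (f : I -> LspaceType1 mu)
    (h : LspaceType1 mu) :
  h = (fun t => \sum_i f i t) %[ae mu] -> J h = (fun x => \sum_i J (f i) x).
Proof.
move=> hE; have [s [sE JsE]] := isometry_sum_exists f.
have -> : J h = fun x => 1 * J s x.
  apply: isometry_ae_eq; apply: filterS2 hE sE => t /= ht st tT.
  by rewrite ht // st // mul1r.
by apply/funext => x; rewrite JsE mul1r.
Qed.

End L1_dual.

(** * Decomposition of functionals with sum zero *)

Lemma dual_norm_le (R : realType) (X : normedModType R) (phi : X -> R) (m : R)
    (x : X) :
  scalar phi -> dual_norm phi = m%:E -> `|phi x| <= m * `|x|.
Proof.
move=> sphi phim.
have ub y : `|y| <= 1 -> `|phi y| <= m.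
  by move=> y1; rewrite -lee_fin -phim; apply: ereal_sup_ubound; exists y.
have [->|x0] := eqVneq x 0.
  by rewrite (scalar0 sphi) !normr0 mulr0.
have nx : 0 < `|x| by rewrite normr_gt0.
rewrite -ler_pdivrMr // -(normr_id x) -normfV mulrC -normrM -(scalarZ sphi).
apply: ub.
by rewrite normrZ normfV normr_id mulVf ?gt_eqF.
Qed.

(** [transfer] is applied pointwise to the L_1 representatives [f i] of the [phi i], and the pieces
    are mapped back by [J]. With [m i j] the norm of a piece, integrating [sum_j |g_ij| = |f_i|]
    makes the norms add up exactly. *)
Lemma L1_predual_decomposition (R : realType) (X : completeNormedModType R)
    (I : finType) (phi : I -> X -> R) :
  L1_predual X -> (forall i, continuous_dual X (phi i)) ->
  (forall x, \sum_i phi i x = 0) ->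
  exists (gamma : I -> I -> X -> R) (m : I -> I -> R),
  [/\ forall i j, [/\ scalar (gamma i j), 0 <= m i j
                   & forall x, `|gamma i j x| <= m i j * `|x|],
      forall i j x, gamma j i x = - gamma i j x,
      forall i x, phi i x = \sum_j gamma i j x,
      forall i j, m j i = m i j
    & forall i, dual_norm (phi i) = (\sum_j m i j)%:E].
Proof.
move=> [d [T [mu [J hJ]]]] cphi phi0.
have [rJ _ nJ] := hJ.
have /choice[f Jf] i : exists f : LspaceType1 mu, J f = phi i.
  have : range J (phi i) by rewrite rJ; exact: cphi.
  by case=> F _ FE; exists F.
have mf (F : LspaceType1 mu) : measurable_fun setT (F : T -> R).
  exact: (measurable_funP (repr (F : {mfun_ mu, T >-> measurableTypeR R}))).
(* [J] maps the class of the sum to the zero functional, so by isometry its L_1-norm is 0. *)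
have f0 : {ae mu, forall t, \sum_i f i t = 0}.
  have [s [sE Js]] := isometry_sum_exists hJ f.
  have Js0 : J s = fun=> 0.
    apply/funext => x; rewrite Js -[RHS](phi0 x).
    by apply: eq_bigr => i _; rewrite Jf.
  have s0 : 'N[mu]_1[EFin \o s]%E = 0%E.
    rewrite -nJ Js0; apply/eqP; rewrite eq_le; apply/andP; split.
      by apply: ge_ereal_sup => _ [x _ <-]; rewrite normr0.
    by apply: ereal_sup_ubound; exists 0 => //=; rewrite normr0.
  have ms : measurable_fun setT (EFin \o (s : T -> R)).
    by apply/measurable_EFinP; exact: mf.
  have s0E := Lnorm_eq0_eq0 ms lte01 s0.
  by apply: filterS2 sE s0E => t /= st s0t; rewrite -st //;
     have [] := s0t Logic.I.
have /choice[g gE] (ij : I * I) : exists g : LspaceType1 mu,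
    g = (fun t => transfer (f ^~ t) ij.1 ij.2) %[ae mu].
  apply: Lspace1_class; apply/Lfun1_integrable.
  apply: (@le_integrable _ _ _ mu setT _ _
    (fun t => (`|f ij.1 t|)%:E + (`|f ij.2 t|)%:E)%E) => //.
  - by apply/measurable_EFinP; apply: measurable_transfer.
  - move=> t _ /=; rewrite lee_fin [leRHS]ger0_norm ?addr_ge0 //.
    exact: norm_transfer_le.
  - by apply: integrableD => //; apply/Lfun1_integrable; apply: Lfun_norm;
      exact: Lspace1_Lfun.
have ng ij : 'N[mu]_1[EFin \o g ij]%E \is a fin_num.
  rewrite fin_numElt (lt_le_trans _ (Lnorm_ge0 _ _ _)) //=.
  exact: Lebesgue_finite.
pose m i j : R := fine 'N[mu]_1[EFin \o g (i, j)]%E.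
have gN i j : g (j, i) = (fun t => -1 * g (i, j) t) %[ae mu].
  apply: filterS2 (gE (j, i)) (gE (i, j)) => t /= gt1 gt2 tT.
  by rewrite gt1 // gt2 // transferN mulN1r.
have gEi i : {ae mu, forall t, forall j, g (i, j) t = transfer (f ^~ t) i j}.
  by apply: filter_forall => j; apply: filterS (gE (i, j)) => t; apply.
exists (fun i j => J (g (i, j))), m; split.
- move=> i j.
  have [sJ _] : continuous_dual X (J (g (i, j))).
    by rewrite -rJ; exists (g (i, j)).
  split=> // [|x]; first exact/fine_ge0/Lnorm_ge0.
  by apply: dual_norm_le; rewrite // nJ /m fineK.
- by move=> i j x; rewrite (isometry_ae_eq hJ (gN i j)) mulN1r.
- move=> i x.
  have fE : f i = (fun t => \sum_j g (i, j) t) %[ae mu].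
    apply: filterS2 f0 (gEi i) => t /= ft gt _; rewrite -(sum_transfer i ft).
    by apply: eq_bigr => j _; rewrite gt.
  by rewrite -Jf (isometry_sum hJ fE).
- move=> i j; rewrite /m; congr fine; rewrite !Lnorm1.
  apply: ge0_ae_eq_integral => //.
  + by apply: measurableT_comp => //; apply/measurable_EFinP.
  + by apply: measurableT_comp => //; apply/measurable_EFinP.
  + by apply: filterS (gN i j) => t /= gt /gt ->; rewrite mulN1r normrN.
- move=> i; rewrite -Jf nJ -sumEFin.
  rewrite (eq_bigr (fun j => (\int[mu]_t `|(g (i, j) t)%:E|)%E)); last first.
    by move=> j _; rewrite fineK // Lnorm1.
  rewrite -ge0_integral_sum //; last first.
    by move=> j; apply: measurableT_comp => //; apply/measurable_EFinP.
  rewrite Lnorm1; apply: ge0_ae_eq_integral => //.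
  + by apply: measurableT_comp => //; apply/measurable_EFinP.
  + apply: emeasurable_sum => j.
    by apply: measurableT_comp => //; apply/measurable_EFinP.
  + by move=> t _; apply: sume_ge0.
  apply: filterS2 f0 (gEi i) => t /= ft gt _.
  rewrite sumEFin -(sum_norm_transfer i ft).
  by congr (_%:E); apply: eq_bigr => j _; rewrite gt.
Qed.

Lemma bounded_scalar_continuous (R : realType) (X : normedModType R)
    (phi : X -> R) (k : R) :
  scalar phi -> (forall x, `|phi x| <= k * `|x|) -> continuous phi.
Proof.
move=> sphi phik x; apply/cvgrPdist_le => e e0.
have k0 : 0 < `|k| + 1 by rewrite ltr_wpDl.
near=> y; rewrite -(scalarB sphi); apply: (le_trans (phik _)).
have : `|x - y| <= e / (`|k| + 1).
  near: y; apply: cvgr_dist_le; first exact: cvg_id.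
  by rewrite divr_gt0.
rewrite ler_pdivlMr // => xy; apply: le_trans xy.
by rewrite mulrC; apply: ler_wpM2l => //; have := ler_norm k; lra.
Unshelve. all: by end_near. Qed.

Lemma predual_sum_le (R : realType) (X : completeNormedModType R) (I : finType)
    (phi : I -> X -> R) (x : I -> X) (r N : I -> R) :
  L1_predual X -> (forall i, continuous_dual X (phi i)) ->
  (forall y, \sum_i phi i y = 0) ->
  (forall i, dual_norm (phi i) = (N i)%:E) ->
  (forall i j, `|x i - x j| <= r i + r j) ->
  \sum_i phi i (x i) <= \sum_i r i * N i.
Proof.
move=> hX cphi phi0 phiN xr.
have [g [m [gm gN gE mC mE]]] := L1_predual_decomposition hX cphi phi0.
have NE i : N i = \sum_j m i j by apply: EFin_inj; rewrite -phiN mE.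
pose A := \sum_i \sum_j g i j (x i).
have -> : \sum_i phi i (x i) = A by apply: eq_bigr => i _; rewrite gE.
have AN : A = - \sum_i \sum_j g i j (x j).
  rewrite /A exchange_big -sumrN; apply: eq_bigr => i _.
  by rewrite -sumrN; apply: eq_bigr => j _; rewrite gN.
pose S := \sum_i \sum_j r i * m i j.
have -> : \sum_i r i * N i = S.
  by apply: eq_bigr => i _; rewrite NE mulr_sumr.
have SC : S = \sum_i \sum_j r j * m i j.
  rewrite /S exchange_big; apply: eq_bigr => i _; apply: eq_bigr => j _.
  by rewrite mC.
(* Doubling lets antisymmetry of [g] and symmetry of [m] pair the terms into [g i j (x i - x j)] and
   [(r i + r j) * m i j]. *)
suff : A + A <= S + S by lra.
rewrite [in X in X + _ <= _]/A [X in _ + X <= _]AN -sumrB.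
rewrite {1}/S SC -big_split /=.
apply: ler_sum => i _; rewrite -sumrB -big_split /=.
apply: ler_sum => j _; have [sg m0 gle] := gm i j.
rewrite -(scalarB sg) -mulrDl mulrC; apply: (le_trans (ler_norm _)).
by apply: (le_trans (gle _)); exact: ler_wpM2l.
Qed.

(** * Finite families of balls *)

Section weighted_max.
Context (R : realType) (X : normedModType R) (I : finType) (rho : I -> R).
Hypothesis rho_gt0 : forall i, 0 < rho i.

(** The norm on [X^I] whose unit ball is the product of the balls of radii [rho i]. *)
Definition weighted_max (u : {ffun I -> X}) : R :=
  \big[Num.max/0]_i (`|u i| / rho i).

Lemma weighted_max_le (u : {ffun I -> X}) (c : R) :
  0 <= c -> (forall i, `|u i| <= c * rho i) -> weighted_max u <= c.
Proof.
move=> c0 uc; apply/bigmax_leP; split=> // i _.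
by rewrite ler_pdivrMr.
Qed.

Lemma le_weighted_max (u : {ffun I -> X}) i : `|u i| <= weighted_max u * rho i.
Proof. by rewrite -ler_pdivrMr //; exact: le_bigmax. Qed.

Lemma weighted_max_ge0 (u : {ffun I -> X}) : 0 <= weighted_max u.
Proof. exact: bigmax_ge_id. Qed.

Lemma sublinear_weighted_max : sublinear weighted_max.
Proof.
apply: sublinearP => [u v| |t u t0]; apply: weighted_max_le => //.
- by rewrite addr_ge0 ?weighted_max_ge0.
- move=> i; rewrite ffunE mulrDl; apply: (le_trans (ler_normD _ _)).
  by apply: lerD; exact: le_weighted_max.
- by move=> i; rewrite ffunE normr0 mul0r.
- by rewrite mulr_ge0 ?weighted_max_ge0 // ltW.
- move=> i; rewrite ffunE normrZ gtr0_norm // -mulrA ler_pM2l //.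
  exact: le_weighted_max.
Qed.

End weighted_max.

Lemma dual_norm_adherent (R : realType) (X : normedModType R) (phi : X -> R)
    (N e : R) :
  scalar phi -> dual_norm phi = N%:E -> 0 < e ->
  exists2 u : X, `|u| <= 1 & N - e <= phi u.
Proof.
move=> sphi phiN e0.
have fin : dual_norm phi \is a fin_num by rewrite phiN.
have [_ [u u1 <-]] := ub_ereal_sup_adherent e0 fin.
rewrite -/(dual_norm phi) phiN -EFinB lte_fin.
have [_ Nu|_ Nu] := ger0P (phi u); first by exists u => //; exact: ltW.
by exists (- u); [rewrite normrN|rewrite (scalarN sphi); exact: ltW].
Qed.

Lemma predual_finite_balls (R : realType) (X : completeNormedModType R)
    (I : finType) (x : I -> X) (r : I -> R) (e : R) :
  L1_predual X -> (forall i j, `|x i - x j| <= r i + r j) -> 0 < e ->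
  exists y, forall i, `|y - x i| <= r i + e.
Proof.
move=> hX xr e0; apply: contrapT => noy.
pose rho i := r i + e.
have r0 i : 0 <= r i by have := xr i i; rewrite subrr normr0; lra.
have rho0 i : 0 < rho i by rewrite /rho; have := r0 i; lra.
pose shift y : {ffun I -> X} := [ffun i => y - x i].
pose diag y : {ffun I -> X} := [ffun=> y].
have shiftE y : shift y = diag y - [ffun i => x i].
  by apply/ffunP => i; rewrite !ffunE.
have far y : 1 <= weighted_max rho (shift y).
  rewrite leNgt; apply/negP => y1; apply: noy; exists y => i.
  have := le_weighted_max rho0 (shift y) i; rewrite ffunE => h.
  by apply: (le_trans h); rewrite -/(rho i) ler_piMl // ltW.
(* The shifts form an affine set on which the norm is at least 1; Hahn-Banach preserves this bound
   for a linear functional below the norm. *)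
have [Phi [sPhi Phip Phi1]] : exists Phi : {ffun I -> X} -> R,
    [/\ scalar Phi, forall u, Phi u <= weighted_max rho u
      & forall u, range shift u -> 1 <= Phi u].
  apply: hahn_banach_convex.
  - exact: sublinear_weighted_max.
  - by exists (shift 0), 0.
  - move=> _ _ t [y _ <-] [z _ <-] _; exists (t *: y + (1 - t) *: z) => //.
    apply/ffunP => i; rewrite !ffunE !scalerBr addrACA -opprD -scalerDl.
    by rewrite (_ : t + (1 - t) = 1) ?scale1r //; lra.
  - by move=> _ [y _ <-].
have diagZ a y : diag (a *: y) = a *: diag y.
  by apply/ffunP => i; rewrite !ffunE.
have Phi_x : 1 <= - Phi [ffun i => x i].
  have := Phi1 _ (ex_intro2 _ _ 0 Logic.I erefl).
  by rewrite shiftE -(scale0r 0) diagZ scale0r sub0r (scalarN sPhi).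
(* Otherwise the multiple [a *: y] makes [Phi] vanish on a shift, against the lower bound 1. *)
have Phi_diag y : Phi (diag y) = 0.
  apply/eqP; apply/negP => /negP Py0.
  pose a := Phi [ffun i => x i] / Phi (diag y).
  have := Phi1 _ (ex_intro2 _ _ (a *: y) Logic.I erefl).
  by rewrite shiftE diagZ (scalarB sPhi) (scalarZ sPhi) /a divfK // subrr ler10.
pose single i y : {ffun I -> X} := [ffun j => if j == i then y else 0].
pose phi i y := Phi (single i y).
have PhiE u : Phi u = \sum_i phi i (u i).
  rewrite -(scalar_sum sPhi); congr Phi; apply/ffunP => j.
  rewrite sum_ffunE (bigD1 j) //= ffunE eqxx big1 ?addr0 // => i ij.
  by rewrite ffunE eq_sym (negbTE ij).
have sphi i : scalar (phi i).
  move=> a y z; rewrite /phi -sPhi; congr Phi; apply/ffunP => j.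
  by rewrite !ffunE; case: ifP => // _; rewrite scaler0 addr0.
have phi_le i y : phi i y <= (rho i)^-1 * `|y|.
  apply: (le_trans (Phip _)); apply: weighted_max_le => //.
    by rewrite mulr_ge0 // invr_ge0 ltW.
  move=> j; rewrite ffunE; case: eqP => [->|_].
    by rewrite mulrAC mulVf ?mul1r ?gt_eqF.
  by rewrite normr0 !mulr_ge0 // ?invr_ge0 ltW.
have phi_norm i y : `|phi i y| <= (rho i)^-1 * `|y|.
  by rewrite ler_norml phi_le andbT lerNl -(scalarN (sphi i)) -(normrN y).
have cphi i : continuous_dual X (phi i).
  by split=> //; exact: bounded_scalar_continuous (phi_norm i).
have phi0 y : \sum_i phi i y = 0.
  by rewrite -[RHS](Phi_diag y) PhiE; apply: eq_bigr => i _; rewrite ffunE.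
(* Here the decomposition only serves to express the dual norms as real numbers [N i]. *)
have [_ [m [_ _ _ _ phiN]]] := L1_predual_decomposition hX cphi phi0.
pose N i := \sum_j m i j; rewrite -/(N _) in phiN.
have N0 i : 0 <= N i.
  rewrite -lee_fin -phiN; apply: ereal_sup_ubound.
  by exists 0; rewrite /= ?(scalar0 (sphi i)) normr0.
have rN1 : 1 <= \sum_i r i * N i.
  apply: (le_trans Phi_x); rewrite -(scalarN sPhi) PhiE.
  rewrite (eq_bigr (fun i => phi i (- x i))); last first.
    by move=> i _; rewrite !ffunE.
  apply: (predual_sum_le hX cphi phi0 phiN) => i j.
  by rewrite -opprD normrN xr.
(* [Phi] is tested on the tuple of [rho i *: u i], of norm at most 1, where [u i] nearly norms
   [phi i]. The losses [rho i * (d / (s + 1))] total at most [d]; the [+ 1] covers [s = 0]. *)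
have rhoN1 : \sum_i rho i * N i <= 1.
  apply/ler_addgt0Pr => d d0.
  pose s := \sum_i rho i.
  have s0 : 0 <= s by apply: sumr_ge0 => i _; exact: ltW.
  have ds : 0 < d / (s + 1) by rewrite divr_gt0 //; lra.
  have /choice[u uP] i : exists u : X,
      `|u| <= 1 /\ N i - d / (s + 1) <= phi i u.
    by have [u u1 uN] := dual_norm_adherent (sphi i) (phiN i) ds; exists u.
  have := Phip [ffun i => rho i *: u i]; rewrite PhiE.
  have : weighted_max rho [ffun i => rho i *: u i] <= 1.
    apply: weighted_max_le => // i; rewrite ffunE normrZ gtr0_norm // mul1r.
    by rewrite ler_piMr ?(uP i).1 // ltW.
  have : \sum_i rho i * N i <= \sum_i phi i (rho i *: u i) + s * (d / (s + 1)).
    rewrite /s mulr_suml -big_split /=; apply: ler_sum => i _.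
    by rewrite (scalarZ (sphi i)) -mulrDr ler_pM2l // -lerBlDr (uP i).2.
  have : s * (d / (s + 1)) <= d.
    by rewrite mulrA ler_pdivrMr; [nra|lra].
  under [X in _ -> _ -> _ -> X <= _ -> _]eq_bigr do rewrite ffunE.
  lra.
(* Comparing [rhoN1] with [rN1] leaves [e * \sum_i N i <= 0], so all norms vanish, against [rN1]. *)
have : \sum_i N i <= 0.
  rewrite -(pmulr_rle0 _ e0) mulr_sumr.
  have : \sum_i rho i * N i = \sum_i r i * N i + \sum_i e * N i.
    by rewrite -big_split /=; apply: eq_bigr => i _; rewrite mulrDl.
  lra.
move=> sN0; have NE i : N i = 0.
  apply/eqP; rewrite eq_le N0 andbT; apply: le_trans sN0.
  by rewrite (bigD1 i) //= lerDl sumr_ge0.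
by move: rN1; rewrite big1 ?ler10 // => i _; rewrite NE mulr0.
Qed.

(** * Compact families of balls *)

Section compact_balls.
Context (R : realType) (X : completeNormedModType R).
Hypothesis hX : L1_predual X.

Let pairwise_meet (B : set (X * R)) : Prop :=
  forall p q, B p -> B q -> `|p.1 - q.1| <= p.2 + q.2.

Lemma predual_compact_balls_approx (B : set (X * R)) (e : R) :
  compact B -> pairwise_meet B -> 0 < e ->
  exists y, forall p, B p -> `|y - p.1| <= p.2 + e.
Proof.
move=> cB mB e0; have e3 : 0 < e / 3 by lra.
pose T : ptopologicalType :=
  HB.pack (X * R)%type.
have : @compact T B by [].
rewrite compact_cover => /(_ _ B (fun p => (ball p (e / 3))^°)).
case=> [p _|p Bp|D DB Bcov].
- exact: open_interior.
- exists p => //; exact: nbhsx_ballx.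
have DBp (d : D) : B (val d) by apply/set_mem/DB; exact: valP.
have [y yD] :=
  predual_finite_balls hX (fun i j : D => mB _ _ (DBp i) (DBp j)) e3.
exists y => p Bp; have [q qD /interior_subset[]] := Bcov p Bp.
(* Three errors of [e / 3] add up: in the center, in the radius, and in the finite intersection. *)
rewrite -!ball_normE /= => q1 q2.
have := yD [` qD]%fset => /= yq.
have := ler_distD q.1 y p.1; have := ler_norm (q.2 - p.2).
lra.
Qed.

Lemma predual_compact_balls (B : set (X * R)) :
  compact B -> pairwise_meet B -> exists y, forall p, B p -> `|y - p.1| <= p.2.
Proof.
move=> cB mB; pose eps n : R := 2^-1 ^+ n.
have eps0 n : 0 < eps n by rewrite exprn_gt0 // invr_gt0.
have epsS n : eps n = eps n.+1 + eps n.+1 by rewrite /eps exprS; lra.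
pose near_B n y := forall p, B p -> `|y - p.1| <= p.2 + eps n.
have [y0 y0B] : exists y, near_B 0%N y.
  exact: predual_compact_balls_approx cB mB (eps0 0%N).
(* The property of [y] is a premise inside the existential, so that choice yields a total map to
   iterate. *)
have step (ny : nat * X) : exists y', near_B ny.1 ny.2 ->
    near_B ny.1.+1 y' /\ `|y' - ny.2| <= eps ny.1 + eps ny.1.+1.
  case: ny => n y /=; have [yB|yB] := pselect (near_B n y); last by exists y.
  (* By [near_B n y], the ball of radius [eps n] around [y] meets every ball of [B]; adding it to
     the family controls the move from [y] to [y']. *)
  have [||y' y'B] := @predual_compact_balls_approx
    (B `|` [set (y, eps n)]) _ _ _ (eps0 n.+1).
  - by apply: compactU => //; exact: compact_set1.
  - move=> p q [Bp|->] [Bq|->] /=.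
    + exact: mB.
    + by rewrite distrC yB.
    + by rewrite [leRHS]addrC yB.
    + by rewrite subrr normr0 addr_ge0 // ltW.
  exists y' => _; split=> [p Bp|]; first by apply: y'B; left.
  by apply: (y'B (y, eps n)); right.
have [g gP] := choice step.
pose u := fix u n := if n is m.+1 then g (m, u m) else y0.
have uB n : near_B n (u n).
  by elim: n => [//|n IH] /=; have [] := gP (n, u n) IH.
have uS n : `|u n.+1 - u n| <= eps n + eps n.+1.
  by have [] := gP (n, u n) (uB n).
(* A step is at most [3 * eps n.+1], hence below [4 * eps n - 4 * eps n.+1], a difference that
   telescopes. *)
have uD n k : `|u (n + k)%N - u n| <= 4 * eps n - 4 * eps (n + k)%N.
  elim: k => [|k IH]; first by rewrite addn0 subrr normr0; lra.
  have := ler_distD (u (n + k)%N) (u (n + k).+1) (u n).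
  by rewrite addnS; have := uS (n + k)%N; have := epsS (n + k)%N;
    have := eps0 (n + k).+1; lra.
have eps_cvg : eps @ \oo --> (0 : R).
  by apply: cvg_expr; rewrite ger0_norm ?invr_ge0 // invf_lt1 // ltr1n.
have u_cvg : cvg (u @ \oo).
  apply/cauchy_cvgP/cauchy_exP => e e0.
  have e4 : 0 < e / 4 by lra.
  have [N _ NP] := (cvgr0_norm_lt _ eps_cvg _ e4).
  exists (u N); exists N => // n /= Nn.
  rewrite -ball_normE /= distrC -(subnKC Nn).
  have := NP N (leqnn N); rewrite /= gtr0_norm // => eN.
  have := uD N (n - N)%N; have := eps0 (N + (n - N))%N; lra.
exists (lim (u @ \oo)) => p Bp; apply/ler_addgt0Pr => e e0.
have e2 : 0 < e / 2 by lra.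
near \oo => n.
have un : `|lim (u @ \oo) - u n| <= e / 2.
  by near: n; move/cvgrPdist_le : u_cvg; apply.
have en : `|eps n| <= e / 2.
  by near: n; apply: (cvgr0_norm_le _ eps_cvg).
have := ler_distD (u n) (lim (u @ \oo)) p.1; have := uB n p Bp.
by move: en; rewrite gtr0_norm //; lra.
Unshelve. all: by end_near. Qed.

End compact_balls.

(** * Radii, centers and the distance formula *)

Section radius.
Context (R : realType) (X : normedModType R) (F : set X).
Hypotheses (F0 : F !=set0) (cF : compact F).

Lemma radius_at_le x c :
  (forall f, F f -> `|x - f| <= c) -> radius_at x F <= c.
Proof.
move=> xc; apply: ge_sup; first by case: F0 => f Ff; exists `|x - f|, f.
by move=> _ [f Ff <-]; exact: xc.
Qed.

Lemma le_radius_at x f : F f -> `|x - f| <= radius_at x F.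
Proof.
move=> Ff; apply: ub_le_sup; last by exists f.
have [M [_ MF]] := compact_bounded cF.
exists (`|x| + (M + 1)) => _ [g Fg <-].
apply: (le_trans (ler_normB _ _)); rewrite lerD2l.
by apply: MF => //; rewrite ltrDl.
Qed.

Lemma radius_at_ge0 x : 0 <= radius_at x F.
Proof.
by case: F0 => f Ff; apply: le_trans (le_radius_at x Ff).
Qed.

Lemma radius_at_leD x y : radius_at x F <= radius_at y F + `|x - y|.
Proof.
apply: radius_at_le => f Ff; rewrite [leRHS]addrC.
by apply: (le_trans (ler_distD y _ _)); rewrite lerD2l le_radius_at.
Qed.

Lemma rad_in_le (V : set X) v : V v -> rad_in V F <= radius_at v F.
Proof.
move=> Vv; apply: ge_inf; last by exists v.
by exists 0 => _ [x _ <-]; exact: radius_at_ge0.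
Qed.

Lemma le_rad_in (V : set X) c :
  V !=set0 -> (forall v, V v -> c <= radius_at v F) -> c <= rad_in V F.
Proof.
move=> [v Vv] Vc; apply: lb_le_inf; first by exists (radius_at v F), v.
by move=> _ [w Vw <-]; exact: Vc.
Qed.

End radius.

Lemma set_dist_le (R : realType) (X : normedModType R) (A B : set X) a b :
  A a -> B b -> set_dist A B <= `|a - b|.
Proof.
move=> Aa Bb; apply: ge_inf; last by exists a => //; exists b.
by exists 0 => _ [x _ [y _ <-]].
Qed.

Lemma le_set_dist (R : realType) (X : normedModType R) (A B : set X) (c : R) :
  A !=set0 -> B !=set0 -> (forall a b, A a -> B b -> c <= `|a - b|) ->
  c <= set_dist A B.
Proof.
move=> [a Aa] [b Bb] abc; apply: lb_le_inf.
  by exists `|a - b|; exists a => //; exists b.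
by move=> _ [x Ax [y By <-]]; exact: abc.
Qed.

(** The balls around [F] force the common point [c] to be a center; the ball around [v] controls its
    distance to [v]. *)
Lemma predual_center_dist (R : realType) (X : completeNormedModType R)
    (F : set X) (v : X) :
  L1_predual X -> F !=set0 -> compact F ->
  exists2 c, cent_in [set: X] F c
    & `|v - c| <= radius_at v F - rad_in [set: X] F.
Proof.
move=> hX F0 cF; set r := rad_in [set: X] F.
have rv x : r <= radius_at x F by exact: rad_in_le.
(* Any [x] is at least [|f - g| / 2] away from [f] or from [g]. *)
have diam f g : F f -> F g -> `|f - g| <= r + r.
  move=> Ff Fg; suff : `|f - g| / 2 <= r by lra.
  apply: le_rad_in => [|x _]; first by exists 0.
  have := ler_distD x f g; rewrite (distrC f x).
  by have := le_radius_at cF x Ff; have := le_radius_at cF x Fg; lra.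
have [||c cP] := @predual_compact_balls _ _ hX
  (F `*` [set r] `|` [set (v, radius_at v F - r)]).
- apply: compactU; last exact: compact_set1.
  by apply: compact_setX => //; exact: compact_set1.
- move=> [p s] [q t] [[/= Fp ->]|[-> ->]] [[/= Fq ->]|[-> ->]] /=.
  + exact: diam.
  + by rewrite [leRHS]addrC subrK distrC; exact: le_radius_at.
  + by rewrite subrK; exact: le_radius_at.
  + by rewrite subrr normr0; have := rv v; lra.
exists c; last by rewrite distrC; apply: (cP (v, radius_at v F - r)); right.
split=> //; apply/eqP; rewrite eq_le rv andbT.
by apply: radius_at_le => // f Ff; apply: (cP (f, r)); left.
Qed.

Theorem theorem3p12 (R : realType) (X : completeNormedModType R)
    (hX : L1_predual X) (F : set X) (hF0 : F !=set0) (hF : compact F)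
    (V : set X) (hV0 : V !=set0) (hVcl : closed V) (hVconv : convex_set V) :
  rad_in V F = rad_in [set: X] F + set_dist V (cent_in [set: X] F) /\
  (cent_in V F !=set0 <->
   exists v0 x0 : X, [/\ V v0, cent_in [set: X] F x0
                       & set_dist V (cent_in [set: X] F) = `|v0 - x0|]).
Proof.
set r := rad_in [set: X] F; set C := cent_in [set: X] F.
have near v : exists2 c, C c & `|v - c| <= radius_at v F - r.
  exact: predual_center_dist.
have radE : rad_in V F = r + set_dist V C.
  apply/eqP; rewrite eq_le; apply/andP; split.
    (* For [a] in [V] and a center [b], [rad_V(F) <= r(a, F) <= r + |a - b|]. *)
    rewrite -lerBlDl; apply: le_set_dist => // [|a b Va [_ bE]].
      by have [c Cc _] := near 0; exists c.
    rewrite lerBlDl; apply: (le_trans (rad_in_le hF0 hF Va)).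
    by rewrite /r -bE; exact: radius_at_leD.
  apply: le_rad_in => // v Vv; rewrite -lerBrDl.
  by have [c Cc] := near v; apply: le_trans; exact: set_dist_le.
split=> //; split=> [[v [Vv vE]]|[v [x [Vv Cx dE]]]].
  (* For a best [v], [r(v, F) - r] is the distance from [V] to [C], so the center near [v] attains
     it. *)
  have [c Cc vc] := near v; exists v, c; split=> //.
  apply/eqP; rewrite eq_le set_dist_le //=.
  by apply: (le_trans vc); rewrite vE radE addrC addKr.
exists v; split=> //; apply/eqP; rewrite eq_le rad_in_le // andbT.
by rewrite radE dE /r -Cx.2; exact: radius_at_leD.
Qed.
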